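(* For all integers $k\ge 1$, a complete multipartite graph $G$ is in $\widehat{\mathcal{D}}_k$ if and only if for some integers $b\ge a\ge 1$ and $p\ge 2$, $$G=K_{a,\underbrace{b,\dots,b}_{p}},$$ such that $k+1=a+(p-1)b$ and if $p=2$ then $a=b$.
   Context: All graphs are undirected, simple, finite and non-empty. A graph $H$ is a minor of $G$ if a graph isomorphic to $H$ can be obtained from $G$ by a sequence of edge contractions, edge deletions and vertex deletions (after a contraction, parallel edges are replaced by a single edge). $\mathcal{D}_k$ is the class of graphs $G$ such that every minor of $G$ has minimum degree at most $k$. $\widehat{\mathcal{D}}_k$ is the set of minimal forbidden minors of $\mathcal{D}_k$: the graphs $G\notin\mathcal{D}_k$ such that every proper minor of $G$ is in $\mathcal{D}_k$. A graph is complete $c$-partite if its vertices can be $c$-coloured so that two vertices are adjacent if and only if they have distinct colours; it is complete multipartite if it is complete $c$-partite for some $c$. $K_{n_1,\dots,n_c}$ is the complete $c$-partite graph with $n_i$ vertices in the $i$-th colour class. $K_{a,b,\dots,b}$ above has one class of size $a$ and $p$ further classes of size $b$. Equality of graphs means isomorphism. *)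

(* Defs.v *)
From HB Require Import structures.
From mathcomp Require Import all_boot.

Set Implicit Arguments.
Unset Strict Implicit.
Unset Printing Implicit Defensive.

Record sgraph := SGraph {
  vertex :> finType;
  adj : rel vertex;
  adj_sym : symmetric adj;
  adj_irrefl : irreflexive adj;
  vertex_gt0 : 0 < #|vertex|
}.

Definition isomorphic (G H : sgraph) : Prop :=
  exists2 f : G -> H, bijective f & forall x y, adj (f x) (f y) = adj x y.

Definition degree (G : sgraph) (x : G) : nat := #|[set y | adj x y]|.

(* Every degree is less than #|G|, so the default value plays no role. *)
Definition min_degree (G : sgraph) : nat :=
  \big[minn/#|G|]_(x : G) degree x.

Section VertexDeletion.
Variables (G : sgraph) (x : G).

Definition del_vertex_adj : rel {z : G | z != x} :=
  fun u v => adj (val u) (val v).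

Fact del_vertex_sym : symmetric del_vertex_adj.
Proof. by move=> u v; apply: adj_sym. Qed.

Fact del_vertex_irrefl : irreflexive del_vertex_adj.
Proof. by move=> u; apply: adj_irrefl. Qed.

Fact del_vertex_gt0 : 1 < #|G| -> 0 < #|{: {z : G | z != x}}|.
Proof. by move=> G_gt1; rewrite card_sig cardC1 -ltnS prednK // ltnW. Qed.

(* Deleting the only vertex of a graph is not allowed. *)
Definition del_vertex (G_gt1 : 1 < #|G|) : sgraph :=
  SGraph del_vertex_sym del_vertex_irrefl (del_vertex_gt0 G_gt1).
End VertexDeletion.

Section EdgeDeletion.
Variables (G : sgraph) (x y : G).

Definition del_edge_adj : rel G :=
  fun u v => adj u v && ([set u; v] != [set x; y]).

Fact del_edge_sym : symmetric del_edge_adj.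
Proof. by move=> u v; rewrite /del_edge_adj adj_sym setUC. Qed.

Fact del_edge_irrefl : irreflexive del_edge_adj.
Proof. by move=> u; rewrite /del_edge_adj adj_irrefl. Qed.

Definition del_edge : sgraph :=
  SGraph del_edge_sym del_edge_irrefl (vertex_gt0 G).
End EdgeDeletion.

(* The edge xy is contracted onto x: the vertex y disappears, and x becomes
   adjacent to all former neighbours of x or y other than x and y. *)
Section EdgeContraction.
Variables (G : sgraph) (x y : G).

Definition contract_adj : rel {z : G | z != y} :=
  fun u v => (val u != val v) &&
    [|| adj (val u) (val v),
        (val u == x) && adj y (val v)
      | (val v == x) && adj (val u) y].

Fact contract_sym : symmetric contract_adj.
Proof.
move=> u v; rewrite /contract_adj eq_sym [adj (val u) (val v)]adj_sym.
by rewrite [adj y _]adj_sym [adj (val u) y]adj_sym [X in _ || X]orbC.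
Qed.

Fact contract_irrefl : irreflexive contract_adj.
Proof. by move=> u; rewrite /contract_adj eqxx. Qed.

Fact contract_gt0 : adj x y -> 0 < #|{: {z : G | z != y}}|.
Proof.
move=> xy; have x_neq_y : x != y.
  by apply: contraTneq xy => ->; rewrite adj_irrefl.
by apply/card_gt0P; exists (exist _ x x_neq_y).
Qed.

Definition contract (xy : adj x y) : sgraph :=
  SGraph contract_sym contract_irrefl (contract_gt0 xy).
End EdgeContraction.

Inductive minor_step (G : sgraph) : sgraph -> Prop :=
| StepDelVertex (x : G) (G_gt1 : 1 < #|G|) : minor_step G (del_vertex x G_gt1)
| StepDelEdge (x y : G) (xy : adj x y) : minor_step G (del_edge x y)
| StepContract (x y : G) (xy : adj x y) : minor_step G (contract xy).

Inductive minor_steps (G : sgraph) : sgraph -> Prop :=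
| StepsRefl : minor_steps G G
| StepsTrans (G' H : sgraph) :
    minor_step G G' -> minor_steps G' H -> minor_steps G H.

Definition minor (H G : sgraph) : Prop :=
  exists2 H', minor_steps G H' & isomorphic H' H.

Definition proper_minor (H G : sgraph) : Prop :=
  minor H G /\ ~ isomorphic H G.

Definition in_D (k : nat) (G : sgraph) : Prop :=
  forall H, minor H G -> min_degree H <= k.

Definition in_Dhat (k : nat) (G : sgraph) : Prop :=
  ~ in_D k G /\ forall H, proper_minor H G -> in_D k H.

Definition complete_partite (c : nat) (G : sgraph) : Prop :=
  exists f : G -> 'I_c, forall x y, adj x y = (f x != f y).

Definition complete_multipartite (G : sgraph) : Prop :=
  exists c, complete_partite c G.

(* K_{n 0, ..., n (c-1)}: a vertex is a colour together with an index in the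
   corresponding class. *)
Section CompleteMultipartite.
Variables (c : nat) (n : 'I_c -> nat).

Definition Kn_adj : rel {i : 'I_c & 'I_(n i)} := fun u v => tag u != tag v.

Fact Kn_sym : symmetric Kn_adj.
Proof. by move=> u v; rewrite /Kn_adj eq_sym. Qed.

Fact Kn_irrefl : irreflexive Kn_adj.
Proof. by move=> u; rewrite /Kn_adj eqxx. Qed.

Fact Kn_gt0 (i : 'I_c) : 0 < n i -> 0 < #|{: {i : 'I_c & 'I_(n i)}}|.
Proof.
move=> ni_gt0; apply/card_gt0P.
by exists (Tagged (fun j => 'I_(n j)) (Ordinal ni_gt0)).
Qed.

Definition Kn (i : 'I_c) (ni_gt0 : 0 < n i) : sgraph :=
  SGraph Kn_sym Kn_irrefl (Kn_gt0 ni_gt0).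
End CompleteMultipartite.

Definition Kab_size (a b p : nat) (i : 'I_p.+1) : nat :=
  if i == ord0 then a else b.

(* K_{a, b, ..., b}: the class of colour 0 has size a, the p others size b. *)
Definition Kab (a b p : nat) (a_gt0 : 0 < a) : sgraph :=
  @Kn p.+1 (Kab_size a b (p := p)) ord0 a_gt0.

(* Main.v *)
(* Let [G] be complete multipartite and minimal for [D_k].  Every vertex has
   degree at least [k+1], and deleting an edge must lower the minimum degree,
   so every edge has an endpoint of degree exactly [k+1]; as the degree of a
   vertex is [#|G|] minus the size of its class, all classes but at most one
   have the same size [b], and the remaining one has size [a <= b].
   Contracting an edge must lower the minimum degree as well, so (every edge
   being dominating) its ends have a common neighbour of degree [k+1].  This
   rules out [p = 1], and also [p = 2] with [a < b].

   Conversely, a connected set of at least two vertices of [K_{a,b,...,b}]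
   contains a dominating edge.  So a minor with [t] vertices coming from such
   sets is a spanning subgraph of the join of [K_t] with a complete
   multipartite graph with classes of sizes [m_0 <= a] and [m_i <= b], where
   [2t + \sum m_i <= a + pb].  Minimum degree [a + (p-1)b] then forces [t = 0]
   and [m_i] maximal, and no edge can be missing because each one has an end
   of degree exactly [a + (p-1)b]. *)

Require Import Defs.
From mathcomp Require Import all_boot zify.

Set Implicit Arguments.
Unset Strict Implicit.
Unset Printing Implicit Defensive.

(** * Minimum degrees, colour classes and isomorphisms *)

Lemma bigmin_leq (I : eqType) (r : seq I) (F : I -> nat) N x :
  x \in r -> \big[minn/N]_(i <- r) F i <= F x.
Proof.
elim: r => // y r IHr; rewrite inE big_cons geq_min => /predU1P[-> | /IHr ->].
  by rewrite leqnn.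
by rewrite orbT.
Qed.

Lemma card_fibers (T I : finType) (D : {set T}) (g : T -> I) :
  #|D| = \sum_i #|[set x in D | g x == i]|.
Proof.
rewrite -sum1_card (partition_big g predT) //=; apply: eq_bigr => i _.
by rewrite -sum1_card; apply: eq_bigl => x; rewrite inE.
Qed.

Lemma card_fibersT (T I : finType) (g : T -> I) :
  #|T| = \sum_i #|[set x | g x == i]|.
Proof.
rewrite -cardsT (card_fibers setT g); apply: eq_bigr => i _.
by apply: eq_card => x; rewrite !inE.
Qed.

Section Degree.
Variable G : sgraph.

Lemma degree_ltn_card (x : G) : degree x < #|G|.
Proof.
rewrite -cardsT; apply: proper_card; rewrite properE subsetT.
by apply/subsetPn; exists x; rewrite !inE // adj_irrefl.
Qed.

Lemma leq_min_degreeP d :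
  reflect (forall x : G, d <= degree x) (d <= min_degree G).
Proof.
apply: (iffP idP) => [le_d x | le_d].
  by apply: leq_trans le_d _; apply: bigmin_leq; apply: mem_index_enum.
have [x _] := card_gt0P (vertex_gt0 G).
rewrite /min_degree; elim/big_ind: _ => [|m n dm dn|y _] //; last by rewrite leq_min dm.
exact: leq_trans (le_d x) (ltnW (degree_ltn_card x)).
Qed.

Lemma minor_refl : minor G G.
Proof. by exists G; [exact: StepsRefl | exists id => //; exists id]. Qed.

Lemma isomorphic_card (H : sgraph) : isomorphic G H -> #|G| = #|H|.
Proof. by case=> f /bij_eq_card. Qed.

Lemma minor_step_minor (H : sgraph) : minor_step G H -> minor H G.
Proof.
move=> GH; exists H; last by exists id => //; exists id.
exact: StepsTrans GH (StepsRefl _).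
Qed.

Lemma degree_coloring (I : eqType) (f : G -> I) (x : G) :
  (forall u v : G, adj u v = (f u != f v)) ->
  degree x + #|[set u | f u == f x]| = #|G|.
Proof.
move=> fP; rewrite /degree -[RHS](cardsC [set y | adj x y]); congr (_ + _).
by apply: eq_card => u; rewrite !inE fP negbK eq_sym.
Qed.

End Degree.

Lemma isomorphic_degree (G H : sgraph) (f : G -> H) (x : G) :
  bijective f -> (forall x y, adj (f x) (f y) = adj x y) ->
  degree (f x) = degree x.
Proof.
move=> [g fK gK] fadj; rewrite /degree -(card_imset _ (can_inj fK)).
apply: eq_card => y; rewrite -[y]gK mem_imset ?inE ?fadj //; exact: can_inj fK.
Qed.

Lemma isomorphic_min_degree (G H : sgraph) d :
  isomorphic G H -> d <= min_degree H -> d <= min_degree G.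
Proof.
case=> f bij_f fadj /leq_min_degreeP le_d; apply/leq_min_degreeP => x.
by rewrite -(isomorphic_degree x bij_f fadj).
Qed.

Lemma isomorphic_sym (G H : sgraph) : isomorphic G H -> isomorphic H G.
Proof.
case=> f [g fK gK] fadj; exists g; first by exists f.
by move=> x y; rewrite -fadj !gK.
Qed.

Lemma card_del_vertex (G : sgraph) (x : G) :
  #|{: {z : G | z != x}}| = #|G|.-1.
Proof. by rewrite card_sig cardC1. Qed.

(** * Minors and subgraph embeddings *)

Definition embeds (H G : sgraph) : Prop :=
  exists2 f : H -> G, injective f & forall x y, adj x y -> adj (f x) (f y).

Lemma embeds_card (H G : sgraph) : embeds H G -> #|H| <= #|G|.
Proof. by case=> f /leq_card. Qed.

Lemma embeds_trans (K H G : sgraph) : embeds K H -> embeds H G -> embeds K G.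
Proof.
case=> f f_inj fadj [g g_inj gadj]; exists (g \o f); first exact: inj_comp.
by move=> x y /fadj/gadj.
Qed.

Lemma isomorphic_embeds (H G : sgraph) : isomorphic H G -> embeds H G.
Proof. by case=> f /bij_inj f_inj fadj; exists f => // x y; rewrite fadj. Qed.

(** Vertex deletion and contraction each lose a vertex, and edge deletion gives a spanning subgraph.
    A minor on as many vertices as [G] is thus a spanning subgraph of [G]. *)
Lemma minor_embeds (G H : sgraph) : minor H G -> #|H| < #|G| \/ embeds H G.
Proof.
have trans (A B C : sgraph) : #|A| < #|B| \/ embeds A B ->
    #|B| < #|C| \/ embeds B C -> #|A| < #|C| \/ embeds A C.
  case=> AB [] BC; first by left; apply: ltn_trans BC.
  - by left; apply: leq_trans AB (embeds_card BC).
  - by left; apply: leq_ltn_trans (embeds_card AB) BC.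
  - by right; apply: embeds_trans BC.
case=> H' steps /isomorphic_sym/isomorphic_embeds HH'.
apply: (trans) (or_intror HH') _.
elim: steps => [A|A B C AB _ /trans]; first by right; exists id.
apply; case: AB => [x G_gt1|x y xy|x y xy].
- by left; rewrite card_del_vertex prednK // vertex_gt0.
- by right; exists id => // u v /andP[].
- by left; rewrite card_del_vertex prednK // vertex_gt0.
Qed.

(* If [H] comes from a complete multipartite graph with classes of sizes [n i]
   by deletions and contractions, then [D] consists of the vertices arising
   from at least two vertices of that graph: each of them uses up two of the
   [N] vertices available, hence the bound on [#|H| + #|D|]. *)
Definition thinned (c : nat) (n : 'I_c -> nat) (N : nat) (H : sgraph) : Prop :=
  exists (D : {set H}) (g : H -> 'I_c),
  [/\ forall x y, x \notin D -> y \notin D -> g x = g y -> ~~ adj x y,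
      #|H| + #|D| <= N
    & forall i, #|[set x in ~: D | g x == i]| <= n i].

(** * Invariance of [thinned] under minors *)

Section Thinned.
Variables (c : nat) (n : 'I_c -> nat) (N : nat).

Lemma thinned_embeds (H G : sgraph) :
  embeds H G -> thinned n N G -> thinned n N H.
Proof.
case=> f f_inj fadj [D [g [gadj leN len]]].
exists (f @^-1: D), (g \o f); split=> [x y|| i].
- rewrite !inE => xD yD /= gxy; apply: contra (gadj _ _ xD yD gxy); exact: fadj.
- apply: leq_trans leN; apply: leq_add; first exact: leq_card f_inj.
  rewrite -(card_imset _ f_inj); apply/subset_leq_card/subsetP=> _ /imsetP[x + ->].
  by rewrite inE.
- apply: leq_trans (len i); rewrite -(card_imset _ f_inj).
  by apply/subset_leq_card/subsetP=> _ /imsetP[x + ->]; rewrite !inE.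
Qed.

(** The merged vertex joins [D]: [D] gains at most one element while the graph loses a vertex.
    Adjacency among the vertices outside the new [D] is unchanged. *)
Lemma thinned_contract (G : sgraph) (x y : G) (xy : adj x y) :
  thinned n N G -> thinned n N (contract xy).
Proof.
case=> D [g [gadj leN len]].
pose D' := [set u : contract xy | val u \in x |: D].
exists D', (g \o val); split=> [u v||i].
- rewrite !inE !negb_or => /andP[ux uD] /andP[vx vD] /= guv.
  rewrite /contract_adj (negPf ux) (negPf vx) /= orbF negb_and.
  by rewrite (gadj _ _ uD vD guv) orbT.
- have : #|D'| <= #|D|.+1.
    rewrite -(card_imset _ val_inj).
    apply: leq_trans (_ : #|x |: D| <= _); last by rewrite cardsU1; case: (_ \notin _).
    by apply/subset_leq_card/subsetP=> _ /imsetP[u + ->]; rewrite inE.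
  have := vertex_gt0 G; rewrite card_del_vertex; lia.
- apply: leq_trans (len i); rewrite -(card_imset _ val_inj).
  apply/subset_leq_card/subsetP=> _ /imsetP[u + ->].
  by rewrite !inE negb_or -andbA => /and3P[_ -> ->].
Qed.

Lemma thinned_step (G H : sgraph) :
  minor_step G H -> thinned n N G -> thinned n N H.
Proof.
case=> [x G_gt1|x y xy|x y xy]; last exact: thinned_contract.
- by apply: thinned_embeds; exists val => //; apply: val_inj.
- by apply: thinned_embeds; exists id => // u v /andP[].
Qed.

End Thinned.

Lemma minor_thinned (c : nat) (n : 'I_c -> nat) N (G H : sgraph) :
  minor H G -> thinned n N G -> thinned n N H.
Proof.
case=> H' steps /isomorphic_sym/isomorphic_embeds HH' tG.
apply: thinned_embeds HH' _.
by elim: steps tG => // A B C AB _ IH tA; apply/IH/(thinned_step AB).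
Qed.

(** This is the extremal count, with [p = q + 2]: high minimum degree leaves no room for merged
    vertices. *)
Lemma thinned_card (a b q : nat) (H : sgraph) :
  0 < a -> a <= b -> (q = 0 -> a = b) ->
  thinned (@Kab_size a b q.+2) (a + q.+2 * b) H ->
  (forall x : H, a + q.+1 * b <= degree x) ->
  #|H| = a + q.+2 * b.
Proof.
move=> a_gt0 le_ab q0_ab [D [g [gadj leN len]]] le_d.
pose m i := #|[set x in ~: D | g x == i]|.
(* A vertex outside [D] misses every vertex of its own class outside [D]. *)
have m_degree i : 0 < m i -> a + q.+1 * b + m i <= #|H|.
  case/card_gt0P => x; rewrite !inE => /andP[xD /eqP gx].
  apply: leq_trans (leq_add (le_d x) (leqnn _)) _.
  rewrite -[#|H|](cardsC [set y | adj x y]) leq_add2l.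
  apply/subset_leq_card/subsetP=> y; rewrite !inE => /andP[yD /eqP gy].
  by apply: gadj => //; rewrite gx gy.
have H_gt : a + q.+1 * b < #|H|.
  have [x _] := card_gt0P (vertex_gt0 H).
  exact: leq_ltn_trans (le_d x) (degree_ltn_card x).
have cardH : #|H| = #|D| + (m ord0 + \sum_(i < q.+2) m (lift ord0 i)).
  rewrite -[LHS](cardsC D) (card_fibers (~: D) g); congr (_ + _).
  exact: big_ord_recl.
have le_m0 : m ord0 <= a by apply: leq_trans (len _) _; rewrite /Kab_size eqxx.
have [j _ maxj] : {j : 'I_q.+2 | true & forall i, m (lift ord0 i) <= m (lift ord0 j)}.
  by case: (arg_maxnP (fun i : 'I_q.+2 => m (lift ord0 i)) (isT : xpredT ord0))
    => j _ maxj; exists j => // i; apply: maxj.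
set B := m (lift ord0 j) in maxj.
have : \sum_(i < q.+2) m (lift ord0 i) <= B + q.+1 * B.
  rewrite (bigD1 j) //= leq_add2l.
  apply: (@leq_trans (\sum_(i < q.+2 | i != j) B)); first exact: leq_sum.
  by rewrite sum_nat_const cardC1 card_ord.
move: leN H_gt (m_degree (lift ord0 j)) (m_degree ord0) cardH le_m0.
rewrite -/B; set S := \sum_(i < _) _; set t := #|D|; set h := #|H|; set m0 := m ord0.
clearbody B S t h m0; clear -a_gt0 le_ab q0_ab => leN H_gt B_deg m0_deg hE le_m0 leS.
have B_gt0 : 0 < B.
  case: (posnP B) => // B0; case: (posnP m0) => [m00|]; first by nia.
  by move/m0_deg; nia.
have {B_deg} := B_deg B_gt0 => B_deg.
have leB : B + t <= b by nia.
(* [B_deg] and [leS] give [a + (q+1)(b-B) <= t + m0], and [b - B >= t] by [leB]. *)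
have key : q * t + a <= m0 by nia.
(* For [q > 0], [key] and [m0 <= a] suffice. For [q = 0], [m0_deg] and [leN] give
   [m0 + t <= b = a <= m0]. *)
have t0 : t = 0.
  have := m0_deg; case: (posnP q) => [q0|]; last by nia.
  have := q0_ab q0; nia.
by nia.
Qed.

(** * Complete multipartite graphs are determined by their class sizes *)

Section ColoredIsomorphism.
Variables (I : finType) (G H : sgraph) (f : G -> I) (g : H -> I).
Hypothesis fP : forall x y, adj x y = (f x != f y).
Hypothesis gP : forall x y, adj x y = (g x != g y).
Hypothesis card_fg : forall i, #|[set x | f x == i]| = #|[set y | g y == i]|.

Lemma isomorphic_colorings : isomorphic G H.
Proof.
have [h0 _] := card_gt0P (vertex_gt0 H).
(* The n-th vertex of each class goes to the n-th vertex of the class of the same colour; [lt_index]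
   keeps [nth] off its default [h0]. *)
pose F x := nth h0 (enum [set y | g y == f x]) (index x (enum [set y | f y == f x])).
have lt_index x : index x (enum [set y | f y == f x]) < size (enum [set y | g y == f x]).
  by rewrite -cardE -card_fg cardE index_mem mem_enum inE.
have gF x : g (F x) = f x.
  have : F x \in enum [set y | g y == f x] by apply: mem_nth.
  by rewrite mem_enum inE => /eqP.
exists F => [|x y]; last by rewrite gP fP !gF.
apply: inj_card_bij => [x y eqF|].
  have fxy : f x = f y by rewrite -!gF eqF.
  move/eqP: eqF; rewrite /F -fxy nth_uniq ?enum_uniq //; last by rewrite fxy.
  by move/eqP/(index_inj x); apply; rewrite mem_enum inE ?fxy.
rewrite (card_fibersT f) (card_fibersT g) leq_eqVlt; apply/orP; left.
by apply/eqP; apply: eq_bigr => i _; rewrite card_fg.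
Qed.
End ColoredIsomorphism.

Lemma card_Kab_fiber (a b p : nat) (a_gt0 : 0 < a) (i : 'I_p.+1) :
  #|[set u : Kab b p a_gt0 | tag u == i]| = Kab_size a b i.
Proof.
rewrite -[RHS]card_ord -cardsT.
rewrite -(card_imset _ (@eq_from_Tagged _ (fun j : 'I_p.+1 => 'I_(Kab_size a b j)) i)).
apply: eq_card => w; rewrite inE; apply/eqP/imsetP => [|[v _ ->] //].
by case: w => j u /= ji; case: _ / ji; exists u.
Qed.

Lemma Kab_coloring (a b p : nat) (a_gt0 : 0 < a) (G : sgraph) :
  isomorphic G (Kab b p a_gt0) ->
  exists2 f : G -> 'I_p.+1, forall x y, adj x y = (f x != f y)
    & forall i, #|[set x | f x == i]| = Kab_size a b i.
Proof.
case=> h bij_h hadj; exists (fun x => tag (h x)) => [x y|i].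
  by rewrite -hadj.
rewrite -(card_Kab_fiber b a_gt0 i) -(card_imset _ (bij_inj bij_h)).
case: bij_h => h' hK h'K; apply: eq_card => u; rewrite inE.
apply/imsetP/idP => [[x + ->]|ui]; first by rewrite inE.
by exists (h' u); rewrite ?inE ?h'K.
Qed.

(** * Sufficiency: the graphs [Kab] are minimal forbidden minors *)

(** If [f x] has degree at most [d], then [f] maps the neighbours of [x] onto those of [f x], so no
    edge at [f x] is missing in [H]. Every edge of [G] has such an end. *)
Lemma embeds_isomorphic (G H : sgraph) d :
  (forall x y : G, adj x y -> (degree x <= d) || (degree y <= d)) ->
  (forall x : H, d <= degree x) -> #|H| = #|G| -> embeds H G ->
  isomorphic H G.
Proof.
move=> low le_d cardHG [f f_inj fadj].
have bij_f : bijective f by apply: inj_card_bij => //; rewrite cardHG.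
have nbr x y : degree (f x) <= d -> adj (f x) (f y) -> adj x y.
  move=> le_fx fxy.
  have : f @: [set z | adj x z] == [set z | adj (f x) z].
    rewrite eqEcard (card_imset _ f_inj) (leq_trans le_fx (le_d x)) andbT.
    by apply/subsetP=> _ /imsetP[z + ->]; rewrite !inE; apply: fadj.
  by move/eqP/setP/(_ (f y)); rewrite (mem_imset _ _ f_inj) !inE fxy.
exists f => // x y; apply/idP/idP; last exact: fadj.
move=> fxy; case/orP: (low _ _ fxy) => le_f; first exact: nbr fxy.
by rewrite adj_sym; apply: nbr => //; rewrite adj_sym.
Qed.

Lemma Kab_in_Dhat (k a b q : nat) (a_gt0 : 0 < a) (G : sgraph) :
  a <= b -> (q = 0 -> a = b) -> k.+1 = a + q.+1 * b ->
  isomorphic G (Kab b q.+2 a_gt0) -> in_Dhat k G.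
Proof.
move=> le_ab q0_ab kE /Kab_coloring[f fP fcard].
have cardG : #|G| = a + q.+2 * b.
  rewrite (card_fibersT f) big_ord_recl fcard /Kab_size eqxx; congr (_ + _).
  under eq_bigr do rewrite fcard /Kab_size /=.
  by rewrite sum_nat_const card_ord.
have degG x : degree x = if f x == ord0 then q.+2 * b else k.+1.
  have := degree_coloring x fP; rewrite fcard /Kab_size cardG.
  by case: ifP => _; lia.
have low (x y : G) : adj x y -> (degree x <= k.+1) || (degree y <= k.+1).
  rewrite !degG fP; case: (f x =P ord0) => [->|_ _]; last by rewrite leqnn.
  by rewrite eq_sym => /negPf->; rewrite leqnn orbT.
have thG : thinned (@Kab_size a b q.+2) (a + q.+2 * b) G.
  exists set0, f; split=> [x y _ _ fxy||i].
  - by rewrite fP fxy eqxx.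
  - by rewrite cards0 addn0 cardG.
  - rewrite -fcard; apply/subset_leq_card/subsetP=> x; rewrite !inE.
    by case/andP.
split=> [/(_ G)|H [HG nisoHG] K KH].
  move=> /(_ (minor_refl G)).
  apply/negP; rewrite -ltnNge; apply/leq_min_degreeP => x; rewrite degG.
  by case: ifP => // _; rewrite kE; nia.
(* If [K] has minimum degree above [k], then [thinned_card] gives it as many vertices as [G]. So [K]
   spans [H], which spans [G]; the degree bound passes from [K] up to [H], and [H] must be all of
   [G]. *)
rewrite leqNgt; apply/negP => /leq_min_degreeP le_d; apply: nisoHG.
have cardK : #|K| = #|G|.
  rewrite cardG; apply: thinned_card q0_ab _ _ => //; last by rewrite -kE.
  exact: minor_thinned KH (minor_thinned HG thG).
have leHG : #|H| <= #|G|.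
  by case: (minor_embeds HG) => [/ltnW //|]; apply: embeds_card.
case: (minor_embeds KH) => [|embKH]; first by rewrite ltnNge cardK leHG.
have cardHK : #|H| = #|K|.
  by apply/eqP; rewrite eqn_leq (embeds_card embKH) andbT cardK.
case: (minor_embeds HG) => [|]; first by rewrite cardHK cardK ltnn.
apply: embeds_isomorphic low _ _; last by rewrite cardHK.
case: embKH => g g_inj gadj x.
have [g' gK g'K] : bijective g by apply: inj_card_bij => //; rewrite cardHK.
apply: leq_trans (le_d (g' x)) _; rewrite /degree -(card_imset _ g_inj).
apply/subset_leq_card/subsetP=> _ /imsetP[z + ->].
by rewrite !inE => /gadj; rewrite g'K.
Qed.

(** * Necessity: degree constraints from edge deletion and contraction *)

Section ForbiddenMinor.
Variables (k : nat) (G : sgraph).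
Hypothesis DhatG : in_Dhat k G.

(** Some minor of [G] has minimum degree above [k]; by minimality it is not proper, hence it is
    isomorphic to [G]. *)
Lemma Dhat_degree (x : G) : k < degree x.
Proof.
apply/leq_min_degreeP: x; rewrite ltnNge; apply/negP => le_k.
case: DhatG => notD properD; apply: notD => H HG.
rewrite leqNgt; apply/negP => lt_k; move: (lt_k); rewrite ltnNge => /negP; apply.
apply: (properD H) (minor_refl H); split=> // /isomorphic_sym isoGH.
by have := isomorphic_min_degree isoGH lt_k; rewrite ltnNge le_k.
Qed.

Lemma Dhat_proper_min_degree (H : sgraph) :
  minor_step G H -> ~ isomorphic H G -> min_degree H <= k.
Proof.
case: DhatG => _ properD GH HG; apply: (properD H) (minor_refl H).
by split=> //; apply: minor_step_minor.
Qed.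

Lemma Dhat_edge (x y : G) :
  adj x y -> (degree x <= k.+1) || (degree y <= k.+1).
Proof.
move=> xy; apply/negPn/negP; rewrite negb_or -!ltnNge => /andP[xk yk].
have xNy : x != y by apply: contraTneq xy => ->; rewrite adj_irrefl.
have : min_degree (del_edge x y) <= k.
  apply: Dhat_proper_min_degree; first exact: StepDelEdge.
  case=> f bij_f fadj.
  (* An isomorphism need not be the identity, so the two graphs are told apart by their numbers of
     ordered adjacent pairs. *)
  have : #|[set u : G * G | adj u.1 u.2 && ([set u.1; u.2] != [set x; y])]| =
      #|[set u : G * G | adj u.1 u.2]|.
    have F_inj : injective (fun u : G * G => (f u.1 : G, f u.2 : G)).
      by move=> [u v] [u' v'] [/(bij_inj bij_f)-> /(bij_inj bij_f)->].
    rewrite -(card_imset _ F_inj); case: bij_f => f' fK f'K.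
    apply: eq_card => -[u v]; rewrite inE /=.
    apply/imsetP/idP => [[[u' v'] + [-> ->]]|uv].
      by rewrite inE /= fadj.
    exists (f' u, f' v); rewrite /= ?f'K //.
    by rewrite inE /= -[_ && _]fadj !f'K.
  apply/eqP; rewrite neq_ltn; apply/orP; left; apply: proper_card.
  apply/properP; split; first by apply/subsetP=> u; rewrite !inE => /andP[].
  by exists (x, y); rewrite !inE //= eqxx andbF.
rewrite leqNgt => /negP; apply; apply/leq_min_degreeP => u.
have out_r v w : w \notin [set x; y] -> [set v; w] != [set x; y].
  by apply: contraNneq => <-; rewrite !inE eqxx orbT.
have end_degree (v w : G) : k.+1 < degree v ->
    (forall z, adj v z -> z != w -> [set v; z] != [set x; y]) ->
    k < degree (v : del_edge x y).
  rewrite /degree (cardsD1 w) => vk vz.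
  have {}vk : k < #|[set z | adj v z] :\ w| by case: (w \in _) vk => //; apply: ltnW.
  apply: leq_trans vk _; apply/subset_leq_card/subsetP => z.
  rewrite !inE /= => /andP[zw vadj]; rewrite /del_edge_adj vadj; exact: vz.
have irr (v z : G) : adj v z -> z != v.
  by apply: contraTneq => ->; rewrite adj_irrefl.
have [->|uNx] := eqVneq u x.
  apply: (end_degree x y) => // z xz zy; apply: out_r.
  by rewrite !inE negb_or zy irr.
have [->|uNy] := eqVneq u y.
  apply: (end_degree y x) => // z yz zx; apply: out_r.
  by rewrite !inE negb_or zx irr.
apply: leq_trans (Dhat_degree u) _.
apply/subset_leq_card/subsetP => z; rewrite !inE /= /del_edge_adj => ->.
by rewrite setUC out_r // !inE negb_or uNx.
Qed.

(** Contraction lowers the degree only of common neighbours of [x] and [y], by one each, apart from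
    the merged vertex. As [xy] dominates, the latter has degree [#|G| - 2 > k], so a common
    neighbour must drop to [k]. *)
Lemma Dhat_contract (x y : G) :
  adj x y -> (forall z, adj x z || adj y z) -> k.+2 < #|G| ->
  exists2 u, adj u x && adj u y & degree u <= k.+1.
Proof.
move=> xy xyz G_gt.
have [/existsP[u /andP[]]|noU] :=
    boolP [exists u, (adj u x && adj u y) && (degree u <= k.+1)]; first by exists u.
have common u : adj u x -> adj u y -> k.+1 < degree u.
  move=> ux uy; rewrite ltnNge; apply: contra noU => le_u.
  by apply/existsP; exists u; rewrite ux uy.
have xNy : x != y by apply: contraTneq xy => ->; rewrite adj_irrefl.
have : min_degree (contract xy) <= k.
  apply: Dhat_proper_min_degree; first exact: StepContract.
  by move/isomorphic_card; rewrite card_del_vertex; have := vertex_gt0 G; lia.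
rewrite leqNgt => /negP[]; apply/leq_min_degreeP => u.
pose nbr := [set v : G | (v != y) && ((val u != v) &&
  [|| adj (val u) v, (val u == x) && adj y v | (v == x) && adj (val u) y])].
have -> : degree u = #|nbr|.
  rewrite /degree -(card_imset _ val_inj); apply: eq_card => v.
  rewrite inE; apply/imsetP/andP => [[w + ->]|[vy uv]].
    by rewrite inE; split=> //; apply: (valP w).
  by exists (exist _ v vy); rewrite ?inE.
case: u @nbr => u uNy /=; set nbr := [set v | _].
have [ux|uNx] := eqVneq u x.
  have : #|~: [set x; y]| <= #|nbr|.
    apply/subset_leq_card/subsetP => v; rewrite !inE negb_or => /andP[vx vy].
    by rewrite vy eq_sym ux vx eqxx /=; case/orP: (xyz v) => ->; rewrite ?orbT.
  by have := cardsC [set x; y]; rewrite cards2 xNy; lia.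
have sub_nbr v : adj u v -> v != y -> v \in nbr.
  move=> uv vy; rewrite inE vy uv andbT /=.
  by apply: contraTneq uv => ->; rewrite adj_irrefl.
have [uy|uNadj] := boolP (adj u y); last first.
  apply: leq_trans (Dhat_degree u) _; apply/subset_leq_card/subsetP => v.
  by rewrite inE => uv; apply: sub_nbr => //; apply: contraNneq uNadj => <-.
have sub1 : [set v | adj u v] :\ y \subset nbr.
  apply/subsetP => v; rewrite in_setD1 inE => /andP[vy uv]; exact: sub_nbr.
have deg1 : degree u = #|[set v | adj u v] :\ y|.+1.
  by rewrite /degree (cardsD1 y) inE uy.
have [ux|uNadj] := boolP (adj u x).
  have := common u ux uy; rewrite deg1 ltnS => lt_k.
  exact: leq_trans lt_k (subset_leq_card sub1).
(* Here [u] sees [y] but not [x]: it trades [y] for the merged vertex [x]. *)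
have := Dhat_degree u; rewrite deg1 => lt_k; apply: leq_trans lt_k _.
apply: proper_card; rewrite properE sub1; apply/subsetPn; exists x.
  by rewrite !inE xNy uNx uy eqxx !orbT.
by rewrite !inE (negPf uNadj) andbF.
Qed.

End ForbiddenMinor.

(** * Necessity: the class sizes and the excluded values of [p] *)

Lemma Dhat_multipartite (k : nat) (G : sgraph) : 1 <= k ->
  complete_multipartite G -> in_Dhat k G ->
  exists (a b p : nat) (a_gt0 : 0 < a),
    [/\ a <= b, 2 <= p, isomorphic G (Kab b p a_gt0),
        k + 1 = a + (p - 1) * b & p = 2 -> a = b].
Proof.
move=> k_gt0 [c [f fP]] DhatG.
pose s i := #|[set x | f x == i]|.
have degE x : degree x + s (f x) = #|G| by apply: degree_coloring.
have deg_gt := Dhat_degree DhatG.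
have [v0 _] := card_gt0P (vertex_gt0 G).
case: (arg_maxnP (fun x : G => degree x) (isT : xpredT v0)) => x0 _ maxx0.
set i0 := f x0; set a := s i0.
have [y0 x0y0] : exists y, adj x0 y.
  have /card_gt0P[y] : 0 < degree x0 by apply: leq_ltn_trans (deg_gt x0).
  by rewrite inE; exists y.
(* Such a vertex is adjacent to [x0], whose degree is maximal; so if either end of that edge has
   degree at most [k+1], this vertex does. *)
have degy x : f x != i0 -> degree x = k.+1.
  rewrite eq_sym -fP => /(Dhat_edge DhatG) le_k.
  apply/eqP; rewrite eqn_leq deg_gt andbT; case/orP: le_k => //.
  by apply: leq_trans; apply: maxx0.
have fy0 : f y0 != i0 by rewrite eq_sym -fP.
set b := s (f y0).
have cardG : #|G| = k.+1 + b by rewrite -(degE y0) degy.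
have sE x : f x != i0 -> s (f x) = b.
  by move=> fx; have := degE x; rewrite degy // cardG; lia.
have a_gt0 : 0 < a by apply/card_gt0P; exists x0; rewrite inE.
have le_ab : a <= b by have := deg_gt x0; have := degE x0; rewrite cardG -/i0 -/a; lia.
(* [L] lists the colours actually used, since [f] need not be onto; the smallest class comes first,
   as in [Kab]. *)
pose A := (f @: [set: G]) :\ i0; pose L := i0 :: enum A.
have fA x : (f x \in A) = (f x != i0) by rewrite in_setD1 imset_f ?inE // andbT.
have L_uniq : uniq L by rewrite /= mem_enum in_setD1 eqxx enum_uniq.
have sizeL : size L = #|A|.+1 by rewrite /= -cardE.
have fL x : f x \in L by rewrite inE mem_enum fA orbN.
have sA i : i \in A -> s i = b.
  by rewrite in_setD1 => /andP[ii /imsetP[x _ ix]]; rewrite ix in ii *; apply: sE.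
pose p := #|A|; pose h x : 'I_p.+1 := inord (index (f x) L).
have hval x : h x = index (f x) L :> nat.
  by rewrite inordK // -sizeL index_mem.
have hP x y : adj x y = (h x != h y).
  rewrite fP; congr (~~ _); apply/eqP/eqP => [fxy|hxy]; first by rewrite /h fxy.
  by rewrite -(nth_index i0 (fL x)) -(nth_index i0 (fL y)) -!hval hxy.
have hcard i : #|[set x | h x == i]| = Kab_size a b i.
  have -> : #|[set x | h x == i]| = s (nth i0 L i).
    apply: eq_card => x; rewrite !inE -val_eqE /= hval.
    apply/eqP/eqP => [<-|->]; first by rewrite nth_index.
    by rewrite index_uniq // sizeL.
  rewrite /Kab_size -val_eqE /=; case: i => [[|i]] //= lt_i.
  by apply: sA; rewrite -mem_enum mem_nth // -cardE.
have iso : isomorphic G (Kab b p a_gt0).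
  apply: (@isomorphic_colorings _ G (Kab b p a_gt0) h (fun u => tag u) hP) => // i.
  by rewrite hcard card_Kab_fiber.
have cardGab : #|G| = a + p * b.
  rewrite (card_fibersT h) big_ord_recl hcard /Kab_size eqxx; congr (_ + _).
  under eq_bigr do rewrite hcard /Kab_size /=.
  by rewrite sum_nat_const card_ord.
have Ay0 : f y0 \in A by rewrite fA.
have p_gt0 : 0 < p by apply/card_gt0P; exists (f y0).
have dominate (x y : G) : adj x y -> forall z : G, adj x z || adj y z.
  move=> + z; rewrite !fP -negb_and; apply: contraNN => /andP[/eqP-> /eqP->].
  exact: eqxx.
(* Two classes leave no triangle. The size condition of [Dhat_contract] holds since
   [b >= a = k + 1 >= 2]. *)
have p_neq1 : p != 1.
  apply/eqP => p1.
  have [||u /andP[ux uy] _] := Dhat_contract DhatG x0y0.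
  - exact: dominate.
  - by rewrite cardG; move: cardGab; rewrite cardG p1; lia.
  have : f u \in A by rewrite fA -fP.
  have /cards1P[i Ai] : p == 1 by rewrite p1.
  by move: Ay0; rewrite Ai !inE => /eqP<- /eqP fu; rewrite fP fu eqxx in uy.
exists a, b, p, a_gt0; split=> //; first by lia.
  by move: cardGab; rewrite cardG; case: (p) p_gt0 => // q _; rewrite subn1 mulSn /=; lia.
(* If [a < b], the edge between the two classes of size [b] has common neighbours only in the class
   of size [a], of degree [2b > a + b = k + 1]. *)
move=> p2; apply/eqP; rewrite eqn_leq le_ab leqNgt; apply/negP => lt_ab.
have [y1 Ay1 y01] : exists2 y1, f y1 \in A & adj y0 y1.
  have : 0 < #|A :\ f y0| by have := cardsD1 (f y0) A; rewrite Ay0 -/p p2; lia.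
  case/card_gt0P => i; rewrite in_setD1 => /andP[iy0 Ai].
  have /imsetP[y1 _ iE] : i \in f @: [set: G] by case/setD1P: Ai.
  by exists y1; rewrite ?fP -iE // eq_sym.
have [||u /andP[uy0 uy1]] := Dhat_contract DhatG y01.
- exact: dominate.
- by rewrite cardG; lia.
have fu : f u = i0.
  apply/eqP; apply: contraTT isT; rewrite -fA => Au.
  have : #|[set f u; f y0; f y1]| <= p.
    apply/subset_leq_card/subsetP => i; rewrite !inE -orbA.
    by case/or3P => /eqP->; rewrite -in_setD1.
  rewrite -setUA cardsU1 cards2 p2 !inE negb_or -!fP uy0 uy1 y01 //.
have := degE u; rewrite fu -/a; move: cardGab; rewrite cardG p2; lia.
Qed.

Theorem theorem1p4 (k : nat) (k_ge1 : 1 <= k) (G : sgraph)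
    (G_multipartite : complete_multipartite G) :
  in_Dhat k G <->
  exists (a b p : nat) (a_ge1 : 1 <= a),
    [/\ a <= b,
        2 <= p,
        isomorphic G (Kab b p a_ge1),
        k + 1 = a + (p - 1) * b
      & p = 2 -> a = b].
Proof.
split; first exact: Dhat_multipartite.
case=> a [b [[|[|q]] [a_gt0 [le_ab // _ isoG kE p2]]]].
apply: Kab_in_Dhat le_ab _ _ isoG => [q0|]; first by apply: p2; rewrite q0.
by rewrite -addn1 kE subn1.
Qed.
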